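(* Let $p\ge 3$ be an integer and let $q_{\text{lin}}=\binom p2-p+3$. Then $$\liminf_{n \rightarrow \infty} \frac{f(n, p, q_{\text{lin}})}{n} \ge 1 - \lim_{n \rightarrow \infty} \frac{F^{(3)}(n; p, p-2)}{n^2}.$$
   Context: For integers $p\ge 3$ and $2\le q\le \binom p2$, a $(p,q)$-coloring of the complete graph $K_n$ is a coloring of the edges of $K_n$ (not necessarily proper) such that every $p$-clique has at least $q$ distinct colors among its edges. The generalized Ramsey number $f(n,p,q)$ is the minimum number of colors for which $K_n$ has a $(p,q)$-coloring. For an $r$-uniform hypergraph $\mathcal{H}$ (without repeated edges), an $(s,k)$-configuration in $\mathcal{H}$ is a set of $s$ vertices inducing $k$ or more edges. $\mathcal{H}$ is $(s,k)$-free if it has no $(s,k)$-configuration. $F^{(r)}(n;s,k)$ denotes the largest possible number of edges in an $(s,k)$-free $r$-uniform hypergraph with $n$ vertices. The existence of the limit $\lim_{n\to\infty} F^{(3)}(n;p,p-2)/n^2$ for fixed $p\ge3$ is a known result of Delcourt and Postle. *)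

(* Defs.v *)
From mathcomp Require Import all_boot.

Set Implicit Arguments.
Unset Strict Implicit.
Unset Printing Implicit Defensive.

Definition edge (n : nat) := {e : {set 'I_n} | #|e| == 2}.

Definition colors_on (n k : nat) (c : {ffun edge n -> 'I_k})
    (S : {set 'I_n}) : {set 'I_k} :=
  [set c e | e : edge n & val e \subset S].

Definition pq_coloring (n k p q : nat) (c : {ffun edge n -> 'I_k}) : bool :=
  [forall S : {set 'I_n}, (#|S| == p) ==> (q <= #|colors_on c S|)].

Definition pq_colorable (n p q k : nat) : bool :=
  [exists c : {ffun edge n -> 'I_k}, pq_coloring p q c].

(* The least k such that K_n has a (p,q)-coloring with k colors.  The search
   can stop at 'C(n, 2): when q <= 'C(p, 2), giving all edges distinct colors
   is a (p,q)-coloring; see [gen_ramseyP]. *)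
Definition gen_ramsey (n p q : nat) : nat :=
  find (pq_colorable n p q) (iota 0 'C(n, 2).+1).

Definition r_uniform (r n : nat) (H : {set {set 'I_n}}) : bool :=
  [forall e in H, #|e| == r].

Definition configuration (n s k : nat) (H : {set {set 'I_n}})
    (S : {set 'I_n}) : bool :=
  (#|S| == s) && (k <= #|H ::&: S|).

Definition sk_free (n s k : nat) (H : {set {set 'I_n}}) : bool :=
  ~~ [exists S : {set 'I_n}, configuration s k H S].

(* F^(r)(n; s, k).  For k > 0 the empty hypergraph is (s,k)-free, so this is
   a maximum over a nonempty family. *)
Definition max_free (r n s k : nat) : nat :=
  \max_(H : {set {set 'I_n}} | r_uniform r H && sk_free s k H) #|H|.

Lemma card_edge (n : nat) : #|{: edge n}| = 'C(n, 2).
Proof.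
by rewrite card_sig -[n in RHS]card_ord -card_draws cardsE.
Qed.

Lemma pq_colorable_rainbow (n p q : nat) :
  q <= 'C(p, 2) -> pq_colorable n p q 'C(n, 2).
Proof.
move=> hq; rewrite -card_edge.
apply/existsP; exists [ffun e => enum_rank e].
apply/forallP => S; apply/implyP => /eqP hS; apply: (leq_trans hq).
rewrite /colors_on card_imset; last by move=> x y; rewrite !ffunE => /enum_rank_inj.
rewrite -hS -cards_draws -(card_imset _ (@val_inj _ _ (edge n))).
apply/subset_leq_card/subsetP => e; rewrite inE => /andP[eS e2].
by apply/imsetP; exists (Sub e e2) => //; rewrite inE.
Qed.

Lemma gen_ramseyP (n p q : nat) : q <= 'C(p, 2) ->
  pq_colorable n p q (gen_ramsey n p q) /\
  (forall k, pq_colorable n p q k -> gen_ramsey n p q <= k).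
Proof.
move=> hq.
have hh : has (pq_colorable n p q) (iota 0 'C(n, 2).+1).
  apply/hasP; exists 'C(n, 2); last exact: pq_colorable_rainbow.
  by rewrite mem_iota /= add0n ltnS.
have hlt : gen_ramsey n p q < 'C(n, 2).+1 by move: hh; rewrite has_find size_iota.
split=> [|k hk]; first by move: (nth_find 0 hh); rewrite nth_iota.
rewrite leqNgt; apply/negP => lt; move: (before_find 0 lt).
by rewrite nth_iota ?(ltn_trans lt) // add0n hk.
Qed.

(* Main.v *)
Require Import Defs.
From mathcomp Require Import all_boot all_order all_algebra.
From mathcomp Require Import all_classical all_reals all_analysis.
From mathcomp Require Import zify ring lra.
Import Order.TTheory GRing.Theory Num.Theory numFieldNormedType.Exports.

(** Let [c] be a (p, q)-coloring of K_n with k colors, q = 'C(p, 2) - p + 3.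
On p vertices the repeats, i.e. the sum over the colors used of (number of
edges of that color) - 1, number at most p - 3.  In particular p vertices span
at most p - 2 edges of a given color.

Fix a color, with edge set E.  By the last remark every tree in E has fewer
than p vertices.  Among the sets of fewer than p vertices that span at least as
many edges of E as they have vertices, let D be a largest one (possibly empty).
Then no edge of E leaves D, at most p^2/2 edges lie in D, and the rest of E is
a forest with components of fewer than p vertices. A tree of the forest on v
vertices is built by adding leaves one at a time; each leaf after the first
edge yields the triple formed by the leaf, its neighbor x and another neighbor
of x, v - 2 triples in all. A vertex set containing t > 0 of these triples
spans more than t edges of E ([sparse_add_leaf], [sparse_setU]). As a tree has
v - 1 = (v + (v - 2)) / 2 edges, the number of triples obtained is at least 2
|E| - n - p^2 ([triples_of_sparse_graph]).

Let H be the union over all colors.  A triple arising from a color contains two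
edges of that color, so distinct colors give distinct triples.  A p-set
containing p - 2 triples of H would have at least p - 2 repeats, so H is
(p, p - 2)-free.  Summing over the colors,
   n (n - 1) <= F + k n + k p^2,   with F = F^(3)(n; p, p - 2)
([pq_coloring_free]); dividing by n^2 and letting n tend to infinity gives the
theorem. *)

(** * Edges and triples inside a vertex set *)

Section FiniteSets.

(* Lemmas such as [subsetP] and [subset_trans] refer here to finite sets. *)
Import mathcomp.boot.fintype mathcomp.boot.finset.

(** The number of members of the hypergraph [E] contained in [S]. *)
Definition inside {T : finType} (E : {set {set T}}) (S : {set T}) : nat :=
  #|E ::&: S|.

(** A set containing t > 0 members of [H] contains more than t members of [E].
When [E] is the set of edges of one color, t triples of [H] in [S] thus
account for at least t repeats of that color in [S]. *)
Definition sparse {T : finType} (E H : {set {set T}}) : Prop :=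
  forall S : {set T}, 0 < inside H S -> inside H S < inside E S.

(** All members of [H] are 3-subsets of [X]. *)
Definition triples_on {T : finType} (X : {set T}) (H : {set {set T}}) : Prop :=
  forall A, A \in H -> #|A| = 3 /\ A \subset X.

(** No member of [E] meets both [X] and its complement: for a graph, [X] is a
union of connected components. *)
Definition closed_set {T : finType} (E : {set {set T}}) (X : {set T}) : Prop :=
  forall e, e \in E -> ~~ [disjoint e & X] -> e \subset X.

(* The arithmetic facts left by counting arguments involve only cardinals:
   membership, inclusion and quantified hypotheses are dropped first. *)
Ltac card_lia := intros; repeat match goal with
  | H : is_true (in_mem _ _) |- _ => clear H
  | H : is_true (~~ _) |- _ => clear H
  | H : is_true [disjoint _ & _] |- _ => clear H
  | H : is_true (_ \subset _) |- _ => clear H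
  | H : sparse _ _ |- _ => clear H
  | H : triples_on _ _ |- _ => clear H
  | H : closed_set _ _ |- _ => clear H
  | H : forall x : {set _}, _ |- _ => clear H
  | H : forall x : nat, _ |- _ => clear H
  end; lia.

Lemma inside_delete {T : finType} (E : {set {set T}}) (S e : {set T}) (y : T) :
  e \in E -> e \subset S -> y \in e -> inside E (S :\ y) < inside E S.
Proof.
move=> eE eS ye; apply/proper_card/properP; split.
  apply/subsetP => f; rewrite !inE => /andP[-> /=].
  by move=> /subset_trans; apply; exact: subD1set.
exists e; first by rewrite inE eE.
by rewrite inE eE /=; apply/negP => /subsetP/(_ _ ye); rewrite !inE eqxx.
Qed.

Lemma inside_disjoint {T : finType} (E : {set {set T}}) (X Y S : {set T}) :
  set0 \notin E -> [disjoint X & Y] -> X \subset S -> Y \subset S ->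
  inside E X + inside E Y <= inside E S.
Proof.
move=> E0 dXY sXS sYS; rewrite /inside -cardsUI.
rewrite [X in _ + #|pred_of_set X|](_ : _ = set0) ?cards0 ?addn0.
  apply/subset_leq_card/subsetP => e; rewrite !inE -andb_orr => /andP[-> /=].
  by case/orP => /subset_trans; apply.
apply/setP => e; rewrite !inE; apply/negP => /andP[/andP[eE eX] /andP[_ eY]].
suff e0 : e = set0 by rewrite -e0 eE in E0.
apply/eqP; rewrite -subset0; apply/subsetP => z ze.
by rewrite -(setI_eq0 X Y) in dXY; rewrite -(eqP dXY) inE (subsetP eX) ?(subsetP eY).
Qed.

Lemma inside_setU {T : finType} (E : {set {set T}}) (U X : {set T}) :
  closed_set E U -> inside E (U :|: X) <= inside E U + inside E X.
Proof.
move=> cU; rewrite /inside; apply: leq_trans (leq_card_setU _ _).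
apply/subset_leq_card/subsetP => e; rewrite !inE => /andP[eE sUX].
rewrite eE /=; case: (boolP [disjoint e & U]) => [dU|/(cU _ eE)->//].
apply/orP; right; apply/subsetP => z ze.
by move: (subsetP sUX z ze); rewrite inE (disjointFr dU ze).
Qed.

Lemma inside_restrict {T : finType} (H : {set {set T}}) (X S : {set T}) :
  triples_on X H -> inside H S = inside H (S :&: X).
Proof.
move=> hH; apply: eq_card => A; rewrite !inE subsetI.
by case: (boolP (A \in H)) => //= /hH[_ ->]; rewrite andbT.
Qed.

Lemma sparse_setU {T : finType} (E H1 H2 : {set {set T}}) (X1 X2 : {set T}) :
  set0 \notin E -> [disjoint X1 & X2] ->
  triples_on X1 H1 -> triples_on X2 H2 ->
  sparse E H1 -> sparse E H2 -> sparse E (H1 :|: H2).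
Proof.
move=> E0 dX t1 t2 s1 s2 S.
have le : inside (H1 :|: H2) S <= inside H1 (S :&: X1) + inside H2 (S :&: X2).
  rewrite -(inside_restrict _ _ _ t1) -(inside_restrict _ _ _ t2).
  apply: leq_trans (leq_card_setU _ _); apply/subset_leq_card/subsetP => A.
  by rewrite !inE -andb_orl.
have dS : [disjoint S :&: X1 & S :&: X2].
  by apply: disjointWl (subsetIr _ _) _; apply: disjointWr (subsetIr _ _) _.
have := inside_disjoint _ _ _ S E0 dS (subsetIl _ _) (subsetIl _ _).
move: (s1 (S :&: X1)) (s2 (S :&: X2)); card_lia.
Qed.

(** If [y] is a new vertex joined to [x], and [x'] is a neighbor of [x], then the
triple [x, x', y] may be added: a set containing it spans the edge [xy], which
is not available without [y], and the first triple in it comes with the two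
edges [xx'] and [xy]. *)
Lemma sparse_add_leaf {T : finType} (E H : {set {set T}}) (X : {set T})
    (x x' y : T) :
  triples_on X H -> sparse E H -> x \in X -> x' \in X -> x != x' -> y \notin X ->
  [set x; x'] \in E -> [set x; y] \in E ->
  [/\ triples_on (y |: X) ([set x; x'; y] |: H),
      sparse E ([set x; x'; y] |: H) & #|[set x; x'; y] |: H| = #|H|.+1].
Proof.
move=> tH sH xX x'X nxx' yX fE eE.
have nyx : y != x by apply: contraNneq yX => ->.
have nyx' : y != x' by apply: contraNneq yX => ->.
split.
- move=> A; rewrite !inE => /orP[/eqP->|/tH[-> sA]]; last first.
    by split=> //; apply: subset_trans sA (subsetUr _ _).
  split; last by rewrite !subUset !sub1set !inE xX x'X eqxx !orbT.
  by rewrite setUC cardsU1 !inE (negPf nyx) (negPf nyx') cards2 nxx'.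
- move=> S; have [sS|nS] := boolP ([set x; x'; y] \subset S); last first.
    suff -> : inside ([set x; x'; y] |: H) S = inside H S by exact: sH.
    apply: eq_card => A; rewrite !inE; case: eqP => [->|//].
    by rewrite (negPf nS) !andbF.
  move: (sS); rewrite !subUset !sub1set => /andP[/andP[xS x'S] yS] _.
  have le : inside ([set x; x'; y] |: H) S <= (inside H (S :\ y)).+1.
    rewrite /inside -add1n -(cards1 [set x; x'; y]).
    apply: leq_trans (leq_card_setU _ _).
    apply/subset_leq_card/subsetP => A.
    rewrite !inE => /andP[/orP[->//|AH] AS]; apply/orP; right.
    rewrite AH /= subsetD1 AS /=; apply: contra yX.
    by have [_ /subsetP] := tH _ AH; apply.
  have lt : inside E (S :\ y) < inside E S.
    by apply: (inside_delete _ _ _ _ eE); rewrite ?subUset ?sub1set ?xS ?yS // !inE eqxx orbT.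
  have pos : 0 < inside E (S :\ y).
    apply/card_gt0P; exists [set x; x']; rewrite !inE fE subUset !sub1set !inE.
    by rewrite xS x'S eq_sym nyx eq_sym nyx'.
  by move: (sH (S :\ y)); card_lia.
- rewrite cardsU1; suff -> : [set x; x'; y] \notin H by [].
  apply/negP => /tH[_ /subsetP/(_ y)]; rewrite !inE eqxx orbT => /(_ isT).
  by rewrite (negPf yX).
Qed.

(** * Triples in a graph that is sparse on small sets *)

Lemma card2_edge {T : finType} (e : {set T}) (x y : T) :
  #|e| = 2 -> x \in e -> y \in e -> x != y -> e = [set x; y].
Proof.
move=> e2 xe ye nxy; apply/eqP; rewrite eq_sym eqEcard e2 cards2 nxy andbT.
by rewrite subUset !sub1set xe ye.
Qed.

(** Suppose that sets of fewer than [m] vertices outside [U] span fewer edges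
than they have vertices, and that sets of [m] vertices outside [U] miss this by
one more.  Let [X] be a set outside [U] that spans at least [#|X| - 1] edges, has
no isolated vertex and carries [#|X| - 2] triples.  Adding to [X] the vertices
joined to it, one at a time, each with an edge and a triple, leads to a closed
set [X'].  It has fewer than [m] vertices, hence at most [#|X'| - 1] edges, and
still carries [#|X'| - 2] triples. *)
Lemma grow_component {T : finType} (E : {set {set T}}) (U : {set T}) (m : nat) :
  (forall e, e \in E -> #|e| = 2) -> closed_set E U ->
  (forall X : {set T}, [disjoint X & U] -> 0 < #|X| < m -> inside E X < #|X|) ->
  (forall X : {set T}, [disjoint X & U] -> #|X| = m -> (inside E X).+1 < #|X|) ->
  forall (X : {set T}) (H : {set {set T}}),
  [disjoint X & U] -> 1 < #|X| < m ->
  (forall x, x \in X -> exists2 x', x' \in X & [set x; x'] \in E) ->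
  #|X| <= (inside E X).+1 -> #|X| <= #|H| + 2 -> triples_on X H -> sparse E H ->
  exists (X' : {set T}) (H' : {set {set T}}),
    [/\ [disjoint X' & U], closed_set E X', 0 < #|X'|, triples_on X' H' & sparse E H']
     /\ 2 * inside E X' <= #|X'| + #|H'|.
Proof.
move=> E2 cU hlt heq X H; have [k] := ubnP (m - #|X|); elim: k X H => // k IH X H.
move=> km dX cX cov leX leH tH sH.
have [cl|] := boolP [forall e in E, [disjoint e & X] || (e \subset X)].
  exists X, H; split; first split=> //; last first.
  - have := hlt _ dX; card_lia.
  - card_lia.
  by move=> e eE; case/orP: (forall_inP cl e eE) => [->|].
case/forall_inPn => e eE; rewrite negb_or => /andP[].
rewrite disjoint_subset => /subsetPn[x xe]; rewrite !inE negbK => xX /subsetPn[y ye yX].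
have nxy : x != y by apply: contraNneq yX => <-.
have eqe := card2_edge _ _ _ (E2 _ eE) xe ye nxy.
have yU : y \notin U.
  apply/negP => yU; suff /subsetP/(_ _ xe) : e \subset U by rewrite (disjointFr dX xX).
  by apply: cU => //; apply/negP => /disjointFr/(_ ye); rewrite yU.
have [x' x'X fE] := cov _ xX.
have nxx' : x != x' by have := E2 _ fE; rewrite cards2; case: (x != x').
rewrite eqe in eE.
have [t' s' c'] := sparse_add_leaf _ _ _ _ _ _ tH sH xX x'X nxx' yX fE eE.
have dX' : [disjoint y |: X & U].
  rewrite disjoint_subset; apply/subsetP => z; rewrite !inE.
  by case/orP => [/eqP->//|/(disjointFr dX)->].
have cX' : #|y |: X| = #|X|.+1 by rewrite cardsU1 yX.
have eX' : inside E X < inside E (y |: X).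
  rewrite -{1}(setU1K yX); apply: (inside_delete _ _ _ _ eE).
    by rewrite subUset !sub1set !inE xX eqxx orbT.
  by rewrite !inE eqxx orbT.
(* Each new vertex brings an edge, so reaching m vertices would violate the
   bound for sets of m vertices. *)
have cm : #|X|.+1 < m.
  have := heq _ dX'; rewrite cX'; card_lia.
apply: (IH (y |: X) ([set x; x'; y] |: H)) => //; rewrite ?cX' ?c'; try card_lia.
move=> z; rewrite !inE => /orP[/eqP->|/cov[z' z'X zE]].
  by exists x; rewrite ?inE ?xX ?orbT // setUC.
by exists z'; rewrite ?inE ?z'X ?orbT.
Qed.

(** The p ^ 2 accounts for the edges inside the largest vertex set [D] with
fewer than [p] vertices that spans at least [#|D|] edges; outside of it the
graph is a forest. *)
Lemma triples_of_sparse_graph {T : finType} (E : {set {set T}}) (p : nat) :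
  2 < p -> (forall e, e \in E -> #|e| = 2) ->
  (forall S : {set T}, #|S| = p -> inside E S <= p - 2) ->
  exists H, [/\ triples_on setT H, sparse E H
     & 2 * #|E| <= #|T| + #|H| + p ^ 2].
Proof.
move=> p3 E2 hE.
have E0 : set0 \notin E by apply/negP => /E2; rewrite cards0.
pose dense (D : {set T}) := (#|D| < p) && (#|D| <= inside E D).
have dense0 : dense set0 by rewrite /dense cards0; card_lia.
case: (arg_maxnP (fun D : {set T} => #|D|) dense0) => D /andP[Dp De] Dmax.
have {}Dmax (X : {set T}) : dense X -> #|X| <= #|D| := Dmax X.
(* Otherwise X :|: D would be a larger dense set. *)
have key (X : {set T}) : [disjoint X & D] -> 0 < #|X| < p - #|D| -> inside E X < #|X|.
  move=> dX cX; rewrite ltnNge; apply/negP => leX.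
  have cXD : #|X :|: D| = #|X| + #|D| by apply/eqP; rewrite (leq_card_setU X D).2.
  have := inside_disjoint _ _ _ (X :|: D) E0 dX (subsetUl _ _) (subsetUr _ _).
  by move=> h; have := Dmax (X :|: D); rewrite /dense cXD; card_lia.
(* Otherwise the p vertices of X :|: D would span p - 1 edges. *)
have key2 (X : {set T}) : [disjoint X & D] -> #|X| = p - #|D| -> (inside E X).+1 < #|X|.
  move=> dX cX.
  have cXD : #|X :|: D| = #|X| + #|D| by apply/eqP; rewrite (leq_card_setU X D).2.
  have := inside_disjoint _ _ _ (X :|: D) E0 dX (subsetUl _ _) (subsetUr _ _).
  by have := hE (X :|: D); rewrite cXD; card_lia.
(* An edge leaving D would give a larger dense set, or one on p vertices. *)
have cD : closed_set E D.
  move=> e eE; rewrite disjoint_subset => /subsetPn[x xe]; rewrite !inE negbK => xD.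
  apply/negPn/negP => /subsetPn[y ye yD].
  have nxy : x != y by apply: contraNneq yD => <-.
  have eqe := card2_edge _ _ _ (E2 _ eE) xe ye nxy.
  have cX' : #|y |: D| = #|D|.+1 by rewrite cardsU1 yD.
  have : inside E D < inside E (y |: D).
    rewrite -{1}(setU1K yD); apply: (inside_delete _ _ _ _ eE) => //.
    by rewrite eqe subUset !sub1set !inE xD eqxx orbT.
  have := Dmax (y |: D); rewrite /dense cX'; have := hE (y |: D); rewrite cX'; card_lia.
(* The components outside D are added to U one at a time. *)
suff main : forall (k : nat) (U : {set T}) (H : {set {set T}}),
    #|T| < k + #|U| -> D \subset U -> closed_set E U ->
    triples_on U H -> sparse E H -> 2 * inside E U <= #|U| + #|H| + p ^ 2 ->
    exists H, [/\ triples_on setT H, sparse E H & 2 * #|E| <= #|T| + #|H| + p ^ 2].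
  apply: (main #|T|.+1 D set0) => //; first card_lia.
  - by move=> A; rewrite inE.
  - by move=> S; rewrite /inside (_ : set0 ::&: S = set0) ?cards0 //; apply/setP => A; rewrite !inE.
  suff : 2 * inside E D <= p ^ 2 by card_lia.
  have : inside E D <= 'C(#|D|, 2).
    rewrite -cards_draws; apply/subset_leq_card/subsetP => e.
    by rewrite !inE => /andP[/E2-> ->].
  have : #|D| * #|D|.-1 <= p * p by apply: leq_mul; card_lia.
  rewrite -mulnn bin2; card_lia.
have leUT (U : {set T}) : #|U| <= #|T| by exact: max_card.
elim=> [|k IH] U H kU sDU cU tH sH leU.
  by have := leUT U; card_lia.
have [sEU|] := boolP [forall e in E, e \subset U].
  exists H; split=> //.
    by move=> A /tH[-> _]; rewrite subsetT.
  have -> : #|E| = inside E U.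
    apply: eq_card => e; rewrite !inE; case: (boolP (e \in E)) => //= eE.
    by rewrite (forall_inP sEU).
  by have := leUT U; card_lia.
case/forall_inPn => e eE neU.
have de : [disjoint e & U] by apply: contraR neU; exact: cU.
have dUD (X : {set T}) : [disjoint X & U] -> [disjoint X & D] by apply: disjointWr.
have [X [H' [[dX cX X0 tH' sH'] leX]]] : exists (X' : {set T}) (H' : {set {set T}}),
    [/\ [disjoint X' & U], closed_set E X', 0 < #|X'|, triples_on X' H' & sparse E H']
     /\ 2 * inside E X' <= #|X'| + #|H'|.
  have ge1 : 0 < inside E e by apply/card_gt0P; exists e; rewrite inE eE /=.
  have e2 := E2 _ eE.
  apply: (grow_component E U (p - #|D|) E2 cU _ _ e set0) => //.
  - by move=> X /dUD; exact: key.
  - by move=> X /dUD; exact: key2.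
  - rewrite e2 /= ltnNge; apply/negP => le2.
    (* #|D| = p - 1 is excluded by a single vertex of e, and #|D| = p - 2 by e
       itself. *)
    have [x xe] : exists x, x \in e by apply/card_gt0P; rewrite e2.
    have sxe : [set x] \subset e by rewrite sub1set.
    have := key2 e (dUD _ de); have := key2 [set x] (dUD _ (disjointWl sxe de)).
    rewrite e2 cards1; card_lia.
  - move=> x xe; move/eqP/cards2P: (e2) => [a [b [_ ab]]]; rewrite ab.
    move: xe (eE); rewrite ab !inE => /orP[]/eqP-> abE.
      by exists b; rewrite // !inE eqxx orbT.
    by exists a; rewrite ?inE ?eqxx // setUC.
  - by rewrite e2.
  - by rewrite e2 cards0.
  - by move=> A; rewrite inE.
  - by move=> S; rewrite /inside (_ : set0 ::&: S = set0) ?cards0 //; apply/setP => A; rewrite !inE.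
have dUX : [disjoint U & X] by rewrite disjoint_sym.
have cUX : #|U :|: X| = #|U| + #|X| by apply/eqP; rewrite (leq_card_setU U X).2.
have cHH : #|H :|: H'| = #|H| + #|H'|.
  apply/eqP; rewrite (leq_card_setU H H').2.
  rewrite -setI_eq0; apply/eqP/setP => A; rewrite !inE; apply/negP => /andP[/tH[A3 AU] /tH'[_ AX]].
  have /card_gt0P[z zA] : 0 < #|A| by rewrite A3.
  by move: (subsetP AX z zA); rewrite (disjointFr dUX (subsetP AU z zA)).
apply: (IH (U :|: X) (H :|: H')).
- card_lia.
- exact: subset_trans sDU (subsetUl _ _).
- move=> f fE; rewrite disjoint_subset => /subsetPn[z zf].
  rewrite !inE negbK => /orP[zU|zX].
    apply: subset_trans (cU f fE _) (subsetUl _ _).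
    by apply/negP => /disjointFr/(_ zf); rewrite zU.
  apply: subset_trans (cX f fE _) (subsetUr _ _).
  by apply/negP => /disjointFr/(_ zf); rewrite zX.
- move=> A; rewrite inE => /orP[/tH|/tH'] [-> sA]; split=> //; apply: subset_trans sA _;
    [exact: subsetUl|exact: subsetUr].
- exact: (sparse_setU _ _ _ U X).
- have := inside_setU _ _ X cU; card_lia.
Qed.

(** * Repeated colors *)

(** The edges of color [i], as vertex pairs. *)
Definition color_class {n k : nat} (c : {ffun edge n -> 'I_k}) (i : 'I_k) :
    {set {set 'I_n}} := [set val e | e : edge n & c e == i].

Lemma inside_color_class {n k : nat} (c : {ffun edge n -> 'I_k}) (i : 'I_k)
    (S : {set 'I_n}) :
  inside (color_class c i) S = #|[set e : edge n | val e \subset S & c e == i]|.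
Proof.
rewrite -(card_imset _ (@val_inj _ _ (edge n))); apply: eq_card => A.
rewrite inE; apply/andP/imsetP => [[/imsetP[e]]|[e]].
  by rewrite inE => ci -> eS; exists e; rewrite // inE eS.
by rewrite inE => /andP[eS ci] ->; rewrite eS imset_f // inE.
Qed.

Lemma color_class_card2 {n k : nat} (c : {ffun edge n -> 'I_k}) (i : 'I_k)
    (e : {set 'I_n}) : e \in color_class c i -> #|e| = 2.
Proof. by case/imsetP => f _ ->; apply/eqP/(valP f). Qed.

Lemma sum_inside_color_class {n k : nat} (c : {ffun edge n -> 'I_k})
    (S : {set 'I_n}) :
  \sum_(i < k) inside (color_class c i) S = 'C(#|S|, 2).
Proof.
transitivity #|[set e : edge n | val e \subset S]|.
  rewrite -sum1_card (partition_big c xpredT) //=; apply: eq_bigr => i _.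
  by rewrite inside_color_class -sum1_card; apply: eq_bigl => e; rewrite !inE.
rewrite -cards_draws -(card_imset _ (@val_inj _ _ (edge n))); apply: eq_card => A.
rewrite inE; apply/imsetP/andP => [[e]|[AS A2]].
  by rewrite inE => eS ->; rewrite eS (valP e).
by exists (Sub A A2); rewrite ?inE ?SubK.
Qed.

Lemma card_colors_on {n k : nat} (c : {ffun edge n -> 'I_k}) (S : {set 'I_n}) :
  #|colors_on c S| = \sum_(i < k) (0 < inside (color_class c i) S).
Proof.
rewrite -sum1_card big_mkcond /=; apply: eq_bigr => i _.
rewrite inside_color_class; suff -> : (i \in colors_on c S) =
    (0 < #|[set e : edge n | val e \subset S & c e == i]|) by case: ltnP.
apply/imsetP/card_gt0P => [[e]|[e]]; rewrite !inE.
  by move=> eS ->; exists e; rewrite inE eS eqxx.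
by case/andP => eS /eqP <-; exists e; rewrite ?inE.
Qed.

(** The sum is the number of repeats in [S]: a color with m > 0 edges in [S]
counts for m - 1, and an unused one for 0. *)
Lemma sum_repeats {n k : nat} (c : {ffun edge n -> 'I_k}) (S : {set 'I_n}) :
  \sum_(i < k) (inside (color_class c i) S).-1 + #|colors_on c S| = 'C(#|S|, 2).
Proof.
rewrite card_colors_on -(sum_inside_color_class c) -big_split /=.
by apply: eq_bigr => i _; case: (inside _ _) => //= m; rewrite addn1.
Qed.

Lemma pq_coloring_repeats {n k p : nat} (c : {ffun edge n -> 'I_k})
    (S : {set 'I_n}) :
  2 < p -> pq_coloring p ('C(p, 2) - p + 3) c -> #|S| = p ->
  \sum_(i < k) (inside (color_class c i) S).-1 <= p - 3.
Proof.
move=> p3 /forallP/(_ S) /implyP hc cS; have := sum_repeats c S.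
by move: (hc (introT eqP cS)); rewrite cS; lia.
Qed.

(** * The hypergraph of all triples *)

Lemma sum_inside {T : finType} {k : nat} (F : 'I_k -> {set {set T}})
    (S : {set T}) :
  \sum_(i < k) inside (F i) S = \sum_(A : {set T} | A \subset S) \sum_(i < k) (A \in F i).
Proof.
rewrite exchange_big /=; apply: eq_bigr => i _.
rewrite /inside -sum1_card [LHS]big_mkcond [RHS]big_mkcond; apply: eq_bigr => A _.
by rewrite !inE; case: (A \in F i); case: (A \subset S).
Qed.

Lemma inside_setT {T : finType} (E : {set {set T}}) : inside E setT = #|E|.
Proof. by apply: eq_card => A; rewrite !inE subsetT andbT. Qed.

(** The triples obtained from all the colors form a (p, p - 2)-free
hypergraph, which is compared with [max_free]. *)
Lemma pq_coloring_free {n k p : nat} (c : {ffun edge n -> 'I_k}) :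
  2 < p -> pq_coloring p ('C(p, 2) - p + 3) c ->
  n * n.-1 <= max_free 3 n p (p - 2) + k * n + k * p ^ 2.
Proof.
move=> p3 hc; pose E := color_class c.
have hE i : exists H : {set {set 'I_n}}, [/\ triples_on setT H, sparse (E i) H
     & 2 * #|E i| <= #|'I_n| + #|H| + p ^ 2].
  apply: triples_of_sparse_graph => // [e|S cS]; first exact: color_class_card2.
  have := pq_coloring_repeats c S p3 hc cS.
  by rewrite (bigD1 i) //= -/(E i); lia.
have [F hF] := fin_all_exists hE.
pose H := [set A | [exists i, A \in F i]].
(* A triple has only 3 pairs and spans at least two edges of each color it
   arises from, so it arises from at most one color. *)
have F1 (A : {set 'I_n}) : \sum_(i < k) (A \in F i) = (A \in H).
  rewrite inE; case: existsP => [[i0 Ai0]|nA]; last first.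
    by rewrite big1 // => i _; case: (boolP (A \in F i)) => // AF; case: nA; exists i.
  have A3 : #|A| = 3 by have [/(_ _ Ai0)[]] := hF i0.
  have : 2 * \sum_(i < k) (A \in F i) <= 'C(#|A|, 2).
    rewrite -(sum_inside_color_class c) big_distrr /=; apply: leq_sum => i _.
    case: (boolP (A \in F i)) => // AF; have [_ sF _] := hF i.
    by apply: (leq_ltn_trans _ (sF A _)); apply/card_gt0P; exists A; rewrite !inE AF /=.
  rewrite A3 (bigD1 i0) //= Ai0 (_ : 'C(3, 2) = 3) //; lia.
have HF (S : {set 'I_n}) : inside H S = \sum_(i < k) inside (F i) S.
  rewrite sum_inside /inside -sum1_card [LHS]big_mkcond [RHS]big_mkcond.
  by apply: eq_bigr => A _; rewrite !inE F1 inE; case: existsP; case: (A \subset S).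
have Hfree : r_uniform 3 H && sk_free p (p - 2) H.
  apply/andP; split.
    apply/forall_inP => A; rewrite inE => /existsP[i Ai].
    by have [/(_ _ Ai)[->]] := hF i.
  apply/existsPn => S; apply/negP => /andP[/eqP cS]; rewrite -/(inside H S) HF.
  have := pq_coloring_repeats c S p3 hc cS.
  have : \sum_(i < k) inside (F i) S <= \sum_(i < k) (inside (color_class c i) S).-1.
    apply: leq_sum => i _; have [_ sF _] := hF i; move: (sF S); rewrite /E; lia.
  lia.
have cH : #|H| <= max_free 3 n p (p - 2).
  by rewrite /max_free (bigD1 H) //= leq_maxl.
have : \sum_(i < k) 2 * #|E i| <= \sum_(i < k) (#|'I_n| + #|F i| + p ^ 2).
  by apply: leq_sum => i _; have [] := hF i.
have -> : \sum_(i < k) 2 * #|E i| = 2 * 'C(n, 2).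
  rewrite -big_distrr /= -[n in 'C(n, 2)]card_ord -cardsT -(sum_inside_color_class c).
  by congr (2 * _); apply: eq_bigr => i _; rewrite inside_setT.
have sF : \sum_(i < k) #|F i| = #|H|.
  by rewrite -inside_setT HF; apply: eq_bigr => i _; rewrite inside_setT.
rewrite !big_split /= sF !sum_nat_const !card_ord.
have -> : 2 * 'C(n, 2) = n * n.-1 by rewrite mulnC (bin_ffact n 2) ffactnS ffactn1.
lia.
Qed.

Lemma gen_ramsey_ge {n p : nat} : 2 < p ->
  n * n.-1 <= max_free 3 n p (p - 2)
    + gen_ramsey n p ('C(p, 2) - p + 3) * (n + p ^ 2).
Proof.
move=> p3; have hq : 'C(p, 2) - p + 3 <= 'C(p, 2).
  have : p * 2 <= p * p.-1 by rewrite leq_mul2l; lia.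
  by rewrite bin2; lia.
have [/existsP[c hc] _] := gen_ramseyP n hq.
by rewrite mulnDr addnA; apply: pq_coloring_free hc.
Qed.

End FiniteSets.

(** * Passage to the limit *)

Local Open Scope classical_set_scope.
Local Open Scope ring_scope.

Lemma cvg_natinv {R : realType} : (n%:R^-1 : R) @[n --> \oo] --> (0 : R).
Proof. by apply/gtr0_cvgV0; [exists 1%N => // n /= n1; rewrite ltr0n|exact: cvgr_idn]. Qed.

Lemma le_limn_einf {R : realType} (u v : (\bar R)^nat) :
  (\forall n \near \oo, (u n <= v n)%E) -> (limn_einf u <= limn_einf v)%E.
Proof.
move=> uv; rewrite !limn_einf_lim; apply: lee_lim.
- exact: is_cvg_einfs.
- exact: is_cvg_einfs.
case: uv => N _ uv; exists N => // n /= Nn.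
apply: le_ereal_inf_tmp => _ [m /= nm <-].
apply: ge_ereal_inf; exists (u m); first by exists m.
by apply: uv; exact: leq_trans nm.
Qed.

Theorem theorem4 (R : realType) (p : nat) (hp : (3 <= p)%N)
    (hlim : cvgn (fun n : nat => (max_free 3 n p (p - 2))%:R / n%:R ^+ 2 : R)) :
  ((1 - limn (fun n : nat => (max_free 3 n p (p - 2))%:R / n%:R ^+ 2 : R))%:E
   <= limn_einf (fun n : nat =>
        ((gen_ramsey n p ('C(p, 2) - p + 3))%:R / n%:R : R)%:E))%E.
Proof.
set a := (fun n : nat => _ : R) in hlim *.
(* u n is the lower bound for the ratio obtained from n (n - 1) <= F + k (n + p ^ 2)
   after division by n ^ 2. *)
pose u (n : nat) : R := (1 - n%:R^-1 - a n) / (1 + (p ^ 2)%:R * n%:R^-1).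
have cu : u n @[n --> \oo] --> (1 - limn a).
  rewrite [X in _ --> X](_ : _ = (1 - 0 - limn a) / (1 + (p ^ 2)%:R * 0)); last first.
    by rewrite mulr0 addr0 subr0 divr1.
  apply: cvgM.
    apply: cvgB hlim; apply: cvgB; [exact: cvg_cst|exact: cvg_natinv].
  apply: cvgV; first by rewrite mulr0 addr0 oner_neq0.
  apply: cvgD; [exact: cvg_cst|]; apply: cvgM; [exact: cvg_cst|exact: cvg_natinv].
rewrite -[leLHS](cvg_limn_einf_sup (cvg_EFin (f := EFin \o u) _ cu)).1; last by apply: nearW.
apply: le_limn_einf; exists 1%N => // n /= n1; rewrite lee_fin /u /a.
have n0 : 0 < n%:R :> R by rewrite ltr0n.
have d0 : 0 < 1 + (p ^ 2)%:R * n%:R^-1 :> R.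
  by rewrite ltr_pwDl // mulr_ge0 // invr_ge0 ler0n.
rewrite ler_pdivrMr //; set P : R := (p ^ 2)%:R.
have : (n * n.-1)%:R <= (max_free 3 n p (p - 2)
    + gen_ramsey n p ('C(p, 2) - p + 3) * (n + p ^ 2))%:R :> R.
  by rewrite ler_nat; exact: gen_ramsey_ge.
rewrite natrD [(n * _)%:R]natrM [(gen_ramsey _ _ _ * _)%:R]natrM natrD -/P -subn1 natrB //.
set f := (max_free _ _ _ _)%:R; set g := (gen_ramsey _ _ _)%:R.
set x := n%:R in n0 *; move=> h.
rewrite -(ler_pM2r (exprn_gt0 2 n0)).
have x0 : x != 0 by rewrite gt_eqF.
have -> : (1 - x^-1 - f / x ^+ 2) * x ^+ 2 = x * (x - 1) - f by field.
have -> : g / x * (1 + P * x^-1) * x ^+ 2 = g * (x + P) by field.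
lra.
Qed.
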